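(* Let $a,b,c\in\mathbb{R}$ with $c\neq 0$ and $(a,b)\neq(0,0)$, and let $p\geq 1$ be an integer. Consider the system for $u=u(t,x)$, $v=v(t,x)$ $$F_1\equiv u_t + a[(u^p + v^p)u]_x + b[(uv)^pv]_x + cu_{xxx} = 0,\qquad F_2\equiv v_t + a[(u^p + v^p)v]_x + b[(uv)^pu]_x + cv_{xxx} = 0.$$ This system is nonlinearly self-adjoint. The substitutions $\bar u=\varphi(t,x,u,v)$, $\bar v=\psi(t,x,u,v)$ realizing the nonlinear self-adjointness are exactly the following (with $\varphi,\psi$ not both identically zero and $c_1,\dots,c_5$ arbitrary real constants): i) if $a=0$ or $p=2$, $$\varphi = c_3u + c_4,\qquad \psi = c_3v + c_5;$$ ii) if $b=0$ and $p=1$, $$\varphi = (2ac_1t + c_2)(v + u) - c_1x + c_4,\qquad \psi = (2ac_1t + c_2)(v + u) - c_1x + c_5;$$ iii) in all other cases, $$\varphi = c_4,\qquad \psi = c_5.$$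
   Context: All functions are smooth. Put $f(u,v)=a(u^p+v^p)u+b(uv)^pv$ and $g(u,v)=a(u^p+v^p)v+b(uv)^pu$. With new dependent variables $\bar u,\bar v$ the formal Lagrangian is $\mathcal{L}=\bar uF_1+\bar vF_2$, and the adjoint expressions are $$F_1^*\equiv-\frac{\delta\mathcal{L}}{\delta u}=\bar u_t+f_u\bar u_x+g_u\bar v_x+c\bar u_{xxx},\qquad F_2^*\equiv-\frac{\delta\mathcal{L}}{\delta v}=\bar v_t+f_v\bar u_x+g_v\bar v_x+c\bar v_{xxx},$$ where $\delta/\delta u,\delta/\delta v$ are the Euler–Lagrange operators. The system is called nonlinearly self-adjoint if there exist functions $\varphi(t,x,u,v)$, $\psi(t,x,u,v)$, not both identically zero, and coefficient functions $M,N,P,Q$ (on the space of $t,x,u,v$ and derivatives of $u,v$) such that $$F_1^*|_{(\bar u,\bar v)=(\varphi,\psi)}=MF_1+NF_2,\qquad F_2^*|_{(\bar u,\bar v)=(\varphi,\psi)}=PF_1+QF_2,$$ where after the substitution derivatives of $\bar u,\bar v$ are replaced by total derivatives of $\varphi,\psi$. Such a pair $(\varphi,\psi)$ is called a substitution (realizing the nonlinear self-adjointness). *)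

(* Defs.v *)
(* Stdlib reals and Coquelicot. *)
From Stdlib Require Import Reals.
From Coquelicot Require Import Coquelicot.

Open Scope R_scope.

(* The dependent variables u, v and the adjoint ones, written \bar u, \bar v
   in mathematical notation. *)
Inductive dvar := U | V | Ubar | Vbar.

(* [Cd w i j] is the jet coordinate standing for d_t^i d_x^j w. *)
Inductive coord := Ct | Cx | Cd (w : dvar) (i j : nat).

Definition coord_eq_dec (k l : coord) : {k = l} + {k <> l}.
Proof. repeat decide equality. Defined.

Definition jet := coord -> R.

Definition upd (z : jet) (k : coord) (s : R) : jet :=
  fun l => if coord_eq_dec l k then s else z l.

Definition partial (k : coord) (F : jet -> R) : jet -> R :=
  fun z => Derive (fun s => F (upd z k s)) (z k).

(* C^infinity: every iterated partial derivative exists and is continuous.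
   Coquelicot's uniformity on [coord -> R] is that of the sup distance; for a
   function of finitely many coordinates this is ordinary continuity in them. *)
Definition smooth (F : jet -> R) : Prop :=
  forall l : list coord,
    let G := List.fold_right partial F l in
    (forall z : coord -> R, continuous G z) /\
    (forall (k : coord) (z : jet), ex_derive (fun s => G (upd z k s)) (z k)).

(* [F] depends only on t, x, u, v and the derivatives of u, v of order <= n. *)
Definition uv_order_le (n : nat) (F : jet -> R) : Prop :=
  forall z z' : jet,
    z Ct = z' Ct -> z Cx = z' Cx ->
    (forall i j, (i + j <= n)%nat ->
       z (Cd U i j) = z' (Cd U i j) /\ z (Cd V i j) = z' (Cd V i j)) ->
    F z = F z'.

Definition coefficient_function (F : jet -> R) : Prop :=
  smooth F /\ exists n, uv_order_le n F.

(* The total derivative d/dt + sum w_{i+1,j} d/dw_{i,j} is a vector field on the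
   jet space with components [shift_t], and acts on functions as the directional
   derivative along it; on a smooth function of finitely many coordinates the sum
   is finite and the two agree by the chain rule.  Likewise for x. *)
Definition shift_t (z : jet) : jet :=
  fun k => match k with Ct => 1 | Cx => 0 | Cd w i j => z (Cd w (S i) j) end.

Definition shift_x (z : jet) : jet :=
  fun k => match k with Ct => 0 | Cx => 1 | Cd w i j => z (Cd w i (S j)) end.

Definition TDt (F : jet -> R) : jet -> R :=
  fun z => Derive (fun s => F (fun k => z k + s * shift_t z k)) 0.

Definition TDx (F : jet -> R) : jet -> R :=
  fun z => Derive (fun s => F (fun k => z k + s * shift_x z k)) 0.

Definition TDtx (i j : nat) (F : jet -> R) : jet -> R :=
  Nat.iter i TDt (Nat.iter j TDx F).

(* Euler-Lagrange operator delta/delta w for Lagrangians of order <= n: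
   sum over i + j <= n of (-1)^(i+j) D_t^i D_x^j (dL / dw_{i,j}); for these
   Lagrangians all further terms of the full operator vanish. *)
Definition euler (n : nat) (w : dvar) (L : jet -> R) : jet -> R :=
  fun z =>
    sum_f_R0 (fun m =>
      sum_f_R0 (fun i =>
        (-1) ^ m * TDtx i (m - i) (partial (Cd w i (m - i)) L) z) m) n.

Definition formal_lagrangian (F1 F2 : jet -> R) : jet -> R :=
  fun z => z (Cd Ubar 0 0) * F1 z + z (Cd Vbar 0 0) * F2 z.

Definition adjoint (n : nat) (w : dvar) (F1 F2 : jet -> R) : jet -> R :=
  fun z => - euler n w (formal_lagrangian F1 F2) z.

Definition on_jets (phi : R -> R -> R -> R -> R) : jet -> R :=
  fun z => phi (z Ct) (z Cx) (z (Cd U 0 0)) (z (Cd V 0 0)).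

(* Replaces the derivatives of ubar, vbar by the corresponding total
   derivatives of phi(t,x,u,v), psi(t,x,u,v). *)
Definition substitute (phi psi : R -> R -> R -> R -> R) (z : jet) : jet :=
  fun k => match k with
  | Cd Ubar i j => TDtx i j (on_jets phi) z
  | Cd Vbar i j => TDtx i j (on_jets psi) z
  | _ => z k
  end.

Definition not_both_zero (phi psi : R -> R -> R -> R -> R) : Prop :=
  ~ (forall t x u v, phi t x u v = 0 /\ psi t x u v = 0).

(* (phi, psi) realizes the nonlinear self-adjointness of the system
   F1 = 0, F2 = 0 of order <= n. *)
Definition is_substitution (n : nat) (F1 F2 : jet -> R)
    (phi psi : R -> R -> R -> R -> R) : Prop :=
  smooth (on_jets phi) /\ smooth (on_jets psi) /\ not_both_zero phi psi /\
  exists M N P Q : jet -> R,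
    coefficient_function M /\ coefficient_function N /\
    coefficient_function P /\ coefficient_function Q /\
    forall z : jet,
      adjoint n U F1 F2 (substitute phi psi z) = M z * F1 z + N z * F2 z /\
      adjoint n V F1 F2 (substitute phi psi z) = P z * F1 z + Q z * F2 z.

Definition nonlinearly_self_adjoint (n : nat) (F1 F2 : jet -> R) : Prop :=
  exists phi psi, is_substitution n F1 F2 phi psi.

Definition eqF1 (a b c : R) (p : nat) : jet -> R :=
  fun z =>
    z (Cd U 1 0)
    + a * TDx (fun y => (y (Cd U 0 0) ^ p + y (Cd V 0 0) ^ p) * y (Cd U 0 0)) z
    + b * TDx (fun y => (y (Cd U 0 0) * y (Cd V 0 0)) ^ p * y (Cd V 0 0)) z
    + c * z (Cd U 0 3).

Definition eqF2 (a b c : R) (p : nat) : jet -> R :=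
  fun z =>
    z (Cd V 1 0)
    + a * TDx (fun y => (y (Cd U 0 0) ^ p + y (Cd V 0 0) ^ p) * y (Cd V 0 0)) z
    + b * TDx (fun y => (y (Cd U 0 0) * y (Cd V 0 0)) ^ p * y (Cd U 0 0)) z
    + c * z (Cd V 0 3).

(* Main.v *)
Require Import Defs.
From Stdlib Require Import Reals Lra Lia FunctionalExtensionality List.
From Coquelicot Require Import Coquelicot.
Open Scope R_scope.

(** A pair (phi, psi) is a substitution exactly when the adjoint system, with
    (phi, psi) in place of (ubar, vbar), vanishes on the solutions of F1 = F2 = 0.
    On the jet space this is an identity in free coordinates: u_t and v_t are
    determined by F1 = F2 = 0 and all x-derivatives of u and v are arbitrary.

    The adjoint expressions are transport equations with the transposed Jacobian
    of the fluxes ([adjointU], [adjointV]):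
      ubar_t + f_u ubar_x + g_u vbar_x + c ubar_xxx.
    The coefficients of u_xx and v_xx come only from c D_x^3 phi; since c <> 0 they
    force phi to be affine in (u, v), with slopes depending on t alone
    ([affine_of_D3]).  Three conditions are left.

    - The u_x terms make the 2 x 2 matrix of slopes symmetric, because g_u does
      not vanish identically ([flux_independent]).
    - The v_x terms say that this matrix times the Jacobian of the fluxes is again
      symmetric.  Splitting the fluxes into their homogeneous parts of degrees p + 1
      (factor a) and 2p + 1 (factor b), and evaluating at a few points, shows that
      only multiples of the identity are possible when a = 0 or p = 2, only multiples
      of the all-ones matrix when b = 0 and p = 1, and only 0 otherwise
      ([symmetrizers_of_jacobian]).
    - The terms without derivatives of u and v give a linear equation for the slopes
      and for the parts gamma(t, x), sigma(t, x) of phi, psi free of u, v; comparing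
      its dependence on u and v determines them ([not_sum_classification],
      [sum_classification]).

    Conversely, these conditions make the adjoint expressions equal to
    alpha F1 + beta F2 and beta F1 + alpha F2, with ((alpha, beta), (beta, alpha)) the
    matrix of slopes ([substitution_of_determining]).  Exchanging u and v exchanges
    the two equations, so the second adjoint expression is the first one with u and v
    exchanged ([adjointV]). *)

(** * Calculus on the jet space *)

Definition dt (phi : R -> R -> R -> R -> R) t x u v := Derive (fun s => phi s x u v) t.
Definition dx (phi : R -> R -> R -> R -> R) t x u v := Derive (fun s => phi t s u v) x.
Definition du (phi : R -> R -> R -> R -> R) t x u v := Derive (fun s => phi t x s v) u.
Definition dv (phi : R -> R -> R -> R -> R) t x u v := Derive (fun s => phi t x u s) v.

Lemma smooth_partial k F : smooth F -> smooth (partial k F).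
Proof.
  intros HF l.
  replace (fold_right partial (partial k F) l) with (fold_right partial F (l ++ k :: nil)).
  - apply HF.
  - now rewrite fold_right_app.
Qed.

Lemma upd_upd z k r s : upd (upd z k r) k s = upd z k s.
Proof.
  apply functional_extensionality; intro l; unfold upd.
  now destruct (coord_eq_dec l k).
Qed.
Lemma upd_same z k s : upd z k s k = s.
Proof. unfold upd; now destruct (coord_eq_dec k k). Qed.

Lemma is_derive_partial F k w r : smooth F ->
  is_derive (fun s => F (upd w k s)) r (partial k F (upd w k r)).
Proof.
  intro HF. destruct (HF nil) as [_ HD]. simpl in HD.
  specialize (HD k (upd w k r)). rewrite upd_same in HD.
  unfold partial. rewrite upd_same.
  assert (E : (fun s => F (upd (upd w k r) k s)) = (fun s => F (upd w k s))).
  { apply functional_extensionality; intro s; now rewrite upd_upd. }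
  rewrite E in *. now apply Derive_correct.
Qed.

(** One step of the chain rule: letting one more coordinate move along a path adds
    that coordinate's contribution to the derivative.  The increment is a value of
    [partial k F] at a nearby point, by the mean value theorem, and continuity of
    [partial k F] gives its limit.  Only finitely many coordinates may be moved this
    way: a path moving all of them need not be continuous for the sup distance. *)
Lemma is_derive_along_upd F k (y : R -> jet) (z : jet) C d A :
  smooth F ->
  (forall s, y s k = z k) ->
  (forall s l, Rabs (y s l - z l) <= C * Rabs s) ->
  is_derive (fun s => F (y s)) 0 A ->
  is_derive (fun s => F (upd (y s) k (z k + s * d))) 0 (A + partial k F z * d).
Proof.
  intros HF Hk HC HA.
  assert (mvt : forall s, exists r, Rabs (r - z k) <= Rabs d * Rabs s /\
    F (upd (y s) k (z k + s * d)) - F (y s) = partial k F (upd (y s) k r) * (s * d)).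
  { intro s.
    destruct (MVT_gen (fun r => F (upd (y s) k r)) (z k) (z k + s * d)
       (fun r => partial k F (upd (y s) k r))) as [r [Hr E]].
    - intros r _. now apply is_derive_partial.
    - intros r _. apply continuity_pt_filterlim.
      apply (ex_derive_continuous (fun r => F (upd (y s) k r))).
      eexists; now apply is_derive_partial.
    - exists r; split.
      + rewrite <- Rabs_mult.
        assert (H : Rabs (r - z k) <= Rabs (s * d)).
        { revert Hr. unfold Rmin, Rmax.
          destruct (Rle_dec (z k) (z k + s * d)); intros [H1 H2];
          unfold Rabs; destruct (Rcase_abs (r - z k)), (Rcase_abs (s * d)); lra. }
        now rewrite (Rmult_comm d s).
      + assert (Ey : upd (y s) k (z k) = y s).
        { apply functional_extensionality; intro l; unfold upd.
          destruct (coord_eq_dec l k) as [->|]; [now rewrite Hk | easy]. }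
        rewrite Ey in E. rewrite E. ring. }
  apply (is_derive_ext (fun s => F (y s) + (F (upd (y s) k (z k + s * d)) - F (y s)))).
  { intro s; apply Rplus_minus. }
  refine (is_derive_plus _ _ _ _ _ HA _).
  apply is_derive_Reals. intros eps Heps.
  destruct (HF (k :: nil)) as [HG _]. simpl in HG. specialize (HG z).
  assert (Hd : 0 < eps / (Rabs d + 1)).
  { apply Rdiv_lt_0_compat; [lra | generalize (Rabs_pos d); lra]. }
  destruct (proj1 (filterlim_locally _ _) HG (mkposreal _ Hd)) as [del Hdel].
  assert (Hm : 0 < Rabs C + Rabs d + 1) by (generalize (Rabs_pos d) (Rabs_pos C); lra).
  assert (Hdel' : 0 < del / (Rabs C + Rabs d + 1)).
  { apply Rdiv_lt_0_compat; [apply cond_pos | lra]. }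
  exists (mkposreal _ Hdel'). simpl. intros h Hh Hhd.
  destruct (mvt h) as [r [Hr E]]. destruct (mvt 0) as [r0 [_ E0]].
  rewrite Rplus_0_l. rewrite E, E0.
  replace ((_ - _) / h - _) with ((partial k F (upd (y h) k r) - partial k F z) * d)
    by (field; assumption).
  assert (Hhm : Rabs h * (Rabs C + Rabs d + 1) < del).
  { apply (Rmult_lt_compat_r _ _ _ Hm) in Hhd.
    unfold Rdiv in Hhd. rewrite Rmult_assoc, Rinv_l, Rmult_1_r in Hhd; lra. }
  assert (HB : ball (partial k F z) (eps / (Rabs d + 1)) (partial k F (upd (y h) k r))).
  { apply (Hdel (upd (y h) k r)). intro l. change (Rabs (upd (y h) k r l - z l) < del).
    assert (HC0 : C * Rabs h <= Rabs C * Rabs h).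
    { apply Rmult_le_compat_r; [apply Rabs_pos | apply Rle_abs]. }
    assert (0 <= Rabs C * Rabs h) by (apply Rmult_le_pos; apply Rabs_pos).
    assert (0 <= Rabs d * Rabs h) by (apply Rmult_le_pos; apply Rabs_pos).
    assert (0 < Rabs h) by (now apply Rabs_pos_lt).
    unfold upd. destruct (coord_eq_dec l k) as [->|].
    - nra.
    - specialize (HC h l). nra. }
  change (Rabs (partial k F (upd (y h) k r) - partial k F z) < eps / (Rabs d + 1)) in HB.
  rewrite Rabs_mult.
  assert (Hd1 : 0 < Rabs d + 1) by (generalize (Rabs_pos d); lra).
  apply (Rmult_lt_compat_r _ _ _ Hd1) in HB.
  unfold Rdiv in HB. rewrite Rmult_assoc, Rinv_l, Rmult_1_r in HB by lra.
  generalize (Rabs_pos (partial k F (upd (y h) k r) - partial k F z)). nra.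
Qed.

Lemma upd_near (y : R -> jet) (z : jet) k C d :
  (forall s l, Rabs (y s l - z l) <= C * Rabs s) ->
  forall s l, Rabs (upd (y s) k (z k + s * d) l - z l) <= (Rmax C (Rabs d)) * Rabs s.
Proof.
  intros H s l. unfold upd. destruct (coord_eq_dec l k) as [->|].
  - replace (z k + s * d - z k) with (d * s) by ring. rewrite Rabs_mult.
    apply Rmult_le_compat_r; [apply Rabs_pos | apply Rmax_r].
  - eapply Rle_trans; [apply H |].
    apply Rmult_le_compat_r; [apply Rabs_pos | apply Rmax_l].
Qed.

Lemma chain_rule phi (z d : jet) :
  smooth (on_jets phi) ->
  is_derive (fun s => on_jets phi (fun k => z k + s * d k)) 0
   (on_jets (dt phi) z * d Ct + on_jets (dx phi) z * d Cx
    + on_jets (du phi) z * d (Cd U 0 0) + on_jets (dv phi) z * d (Cd V 0 0)).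
Proof.
  intro HF.
  assert (N0 : forall (s : R) (l : coord), Rabs (z l - z l) <= 0 * Rabs s).
  { intros s l. rewrite Rminus_diag, Rabs_R0. lra. }
  assert (N1 := upd_near (fun _ => z) z Ct _ (d Ct) N0).
  assert (N2 := upd_near _ z Cx _ (d Cx) N1).
  assert (N3 := upd_near _ z (Cd U 0 0) _ (d (Cd U 0 0)) N2).
  assert (D0 : is_derive (fun s : R => on_jets phi z) 0 0) by exact (is_derive_const _ _).
  assert (D1 := is_derive_along_upd _ Ct (fun _ => z) z _ (d Ct) _ HF (fun _ => eq_refl) N0 D0).
  assert (D2 := is_derive_along_upd _ Cx _ z _ (d Cx) _ HF (fun _ => eq_refl) N1 D1).
  assert (D3 := is_derive_along_upd _ (Cd U 0 0) _ z _ (d (Cd U 0 0)) _ HF (fun _ => eq_refl) N2 D2).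
  assert (D4 := is_derive_along_upd _ (Cd V 0 0) _ z _ (d (Cd V 0 0)) _ HF (fun _ => eq_refl) N3 D3).
  rewrite Rplus_0_l in D4. exact D4.
Qed.

(** [D1 phi], [D2 phi], [D3 phi] are D_x phi, D_x^2 phi, D_x^3 phi written out with
    the partial derivatives of phi; no symmetry of second derivatives is used. *)
Definition D1 phi (z : jet) :=
  on_jets (dx phi) z + on_jets (du phi) z * z (Cd U 0 1) + on_jets (dv phi) z * z (Cd V 0 1).
Definition D2 phi (z : jet) :=
  D1 (dx phi) z + (D1 (du phi) z * z (Cd U 0 1) + on_jets (du phi) z * z (Cd U 0 2))
    + (D1 (dv phi) z * z (Cd V 0 1) + on_jets (dv phi) z * z (Cd V 0 2)).
Definition D3 phi (z : jet) :=
  D2 (dx phi) z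
  + (D2 (du phi) z * z (Cd U 0 1) + 2 * D1 (du phi) z * z (Cd U 0 2) + on_jets (du phi) z * z (Cd U 0 3))
  + (D2 (dv phi) z * z (Cd V 0 1) + 2 * D1 (dv phi) z * z (Cd V 0 2) + on_jets (dv phi) z * z (Cd V 0 3)).

Lemma smooth_dx phi : smooth (on_jets phi) -> smooth (on_jets (dx phi)).
Proof. apply (smooth_partial Cx). Qed.
Lemma smooth_du phi : smooth (on_jets phi) -> smooth (on_jets (du phi)).
Proof. apply (smooth_partial (Cd U 0 0)). Qed.
Lemma smooth_dv phi : smooth (on_jets phi) -> smooth (on_jets (dv phi)).
Proof. apply (smooth_partial (Cd V 0 0)). Qed.

Definition is_total_x_derivative (G H : jet -> R) :=
  forall z, is_derive (fun s => G (fun k => z k + s * shift_x z k)) 0 (H z).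

Lemma total_x_derivative_TDx G H : is_total_x_derivative G H -> TDx G = H.
Proof. intro D; apply functional_extensionality; intro z; now apply is_derive_unique. Qed.

Lemma total_x_derivative_plus G G' H H' : is_total_x_derivative G G' -> is_total_x_derivative H H' ->
  is_total_x_derivative (fun z => G z + H z) (fun z => G' z + H' z).
Proof. intros DG DH z. exact (is_derive_plus _ _ _ _ _ (DG z) (DH z)). Qed.

Lemma total_x_derivative_mult_coord G G' w i j : is_total_x_derivative G G' ->
  is_total_x_derivative (fun z => G z * z (Cd w i j)) (fun z => G' z * z (Cd w i j) + G z * z (Cd w i (S j))).
Proof.
  intros DG z.
  assert (E : (fun k => z k + 0 * shift_x z k) = z)
    by (apply functional_extensionality; intro; ring).
  assert (Dw : is_derive (fun s => z (Cd w i j) + s * z (Cd w i (S j))) 0 (z (Cd w i (S j)))).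
  { auto_derive; [easy | ring]. }
  evar_last. { exact (is_derive_mult _ _ _ _ _ (DG z) Dw Rmult_comm). }
  cbn beta. rewrite E. unfold plus, mult; simpl. ring.
Qed.

Lemma total_x_derivative_ext G H H' : (forall z, H z = H' z) -> is_total_x_derivative G H -> is_total_x_derivative G H'.
Proof. intros E D z. rewrite <- E. apply D. Qed.

Lemma total_x_derivative_D0 phi : smooth (on_jets phi) -> is_total_x_derivative (on_jets phi) (D1 phi).
Proof.
  intros H z. unfold D1. evar_last. apply chain_rule, H. simpl. ring.
Qed.

Lemma total_x_derivative_D1 phi : smooth (on_jets phi) -> is_total_x_derivative (D1 phi) (D2 phi).
Proof.
  intro H.
  assert (Hx := total_x_derivative_D0 _ (smooth_dx _ H)).
  assert (Hu := total_x_derivative_mult_coord _ _ U 0 1 (total_x_derivative_D0 _ (smooth_du _ H))).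
  assert (Hv := total_x_derivative_mult_coord _ _ V 0 1 (total_x_derivative_D0 _ (smooth_dv _ H))).
  exact (total_x_derivative_plus _ _ _ _ (total_x_derivative_plus _ _ _ _ Hx Hu) Hv).
Qed.

Lemma total_x_derivative_D2 phi : smooth (on_jets phi) -> is_total_x_derivative (D2 phi) (D3 phi).
Proof.
  intro H.
  assert (Hx := total_x_derivative_D1 _ (smooth_dx _ H)).
  assert (Hu := total_x_derivative_mult_coord _ _ U 0 1 (total_x_derivative_D1 _ (smooth_du _ H))).
  assert (Hv := total_x_derivative_mult_coord _ _ V 0 1 (total_x_derivative_D1 _ (smooth_dv _ H))).
  assert (Hu' := total_x_derivative_mult_coord _ _ U 0 2 (total_x_derivative_D0 _ (smooth_du _ H))).
  assert (Hv' := total_x_derivative_mult_coord _ _ V 0 2 (total_x_derivative_D0 _ (smooth_dv _ H))).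
  refine (total_x_derivative_ext _ _ _ _ (total_x_derivative_plus _ _ _ _ (total_x_derivative_plus _ _ _ _ Hx
    (total_x_derivative_plus _ _ _ _ Hu Hu')) (total_x_derivative_plus _ _ _ _ Hv Hv'))).
  intro z; unfold D3; ring.
Qed.

Lemma TDx3_eq_D3 phi : smooth (on_jets phi) -> TDtx 0 3 (on_jets phi) = D3 phi.
Proof.
  intro H. unfold TDtx; simpl.
  rewrite (total_x_derivative_TDx _ _ (total_x_derivative_D0 _ H)), (total_x_derivative_TDx _ _ (total_x_derivative_D1 _ H)).
  apply total_x_derivative_TDx, total_x_derivative_D2, H.
Qed.
Lemma TDx_eq_D1 phi : smooth (on_jets phi) -> TDtx 0 1 (on_jets phi) = D1 phi.
Proof. intro H. apply total_x_derivative_TDx, total_x_derivative_D0, H. Qed.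
Lemma TDt_chain_rule phi z : smooth (on_jets phi) -> TDtx 1 0 (on_jets phi) z =
  on_jets (dt phi) z + on_jets (du phi) z * z (Cd U 1 0) + on_jets (dv phi) z * z (Cd V 1 0).
Proof. intro H. apply is_derive_unique. evar_last. apply chain_rule, H. simpl; ring. Qed.

(** * Polynomial functions on the jet space are smooth *)

Inductive jet_polynomial : (jet -> R) -> Prop :=
| jp_const r : jet_polynomial (fun _ => r)
| jp_coord l : jet_polynomial (fun z => z l)
| jp_plus F G : jet_polynomial F -> jet_polynomial G -> jet_polynomial (fun z => F z + G z)
| jp_mult F G : jet_polynomial F -> jet_polynomial G -> jet_polynomial (fun z => F z * G z).

Lemma upd_id z k : upd z k (z k) = z.
Proof.
  apply functional_extensionality; intro l; unfold upd.
  now destruct (coord_eq_dec l k) as [->|].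
Qed.

Lemma jet_polynomial_continuous F z : jet_polynomial F -> continuous (F : (coord -> R) -> R) z.
Proof.
  induction 1 as [r | l | F G _ IF _ IG | F G _ IF _ IG].
  - apply continuous_const.
  - apply filterlim_locally. intro eps. exists eps. intros y Hy. apply Hy.
  - exact (continuous_plus (V := R_NormedModule) _ _ _ IF IG).
  - exact (continuous_mult (K := R_AbsRing) _ _ _ IF IG).
Qed.

Lemma jet_polynomial_derive F k : jet_polynomial F ->
  exists F', jet_polynomial F' /\ forall z, is_derive (fun s => F (upd z k s)) (z k) (F' z).
Proof.
  induction 1 as [r | l | F G HF [F' [PF DF]] HG [G' [PG DG]] | F G HF [F' [PF DF]] HG [G' [PG DG]]].
  - exists (fun _ => 0). split; [constructor | intro z; exact (is_derive_const _ _)].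
  - unfold upd. destruct (coord_eq_dec l k) as [->|N].
    + exists (fun _ => 1). split; [constructor | intro z; exact (is_derive_id _)].
    + exists (fun _ => 0). split; [constructor | intro z; exact (is_derive_const _ _)].
  - exists (fun z => F' z + G' z). split; [now constructor |].
    intro z. exact (is_derive_plus _ _ _ _ _ (DF z) (DG z)).
  - exists (fun z => F' z * G z + F z * G' z). split; [now repeat constructor |].
    intro z. generalize (is_derive_mult _ _ _ _ _ (DF z) (DG z) Rmult_comm).
    now rewrite upd_id.
Qed.

Lemma jet_polynomial_smooth F : jet_polynomial F -> smooth F.
Proof.
  intros HF l.
  assert (HG : jet_polynomial (fold_right partial F l)).
  { induction l as [|k l IH]; [easy |]. simpl.
    destruct (jet_polynomial_derive _ k IH) as [G' [PG DG]].
    replace (partial k (fold_right partial F l)) with G'; [easy |].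
    apply functional_extensionality; intro z. symmetry. now apply is_derive_unique. }
  split.
  - intro z. now apply jet_polynomial_continuous.
  - intros k z. destruct (jet_polynomial_derive _ k HG) as [G' [_ DG]]. now exists (G' z).
Qed.

(** * Functions affine in u, v *)

Lemma is_derive_dt phi t x u v : smooth (on_jets phi) ->
  is_derive (fun s => phi s x u v) t (dt phi t x u v).
Proof.
  intro H. exact (is_derive_partial _ Ct (fun k => match k with Ct => t | Cx => x
     | Cd U _ _ => u | _ => v end) t H).
Qed.
Lemma is_derive_dx phi t x u v : smooth (on_jets phi) ->
  is_derive (fun s => phi t s u v) x (dx phi t x u v).
Proof.
  intro H. exact (is_derive_partial _ Cx (fun k => match k with Ct => t | Cx => x
     | Cd U _ _ => u | _ => v end) x H).
Qed.
Lemma is_derive_du phi t x u v : smooth (on_jets phi) ->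
  is_derive (fun s => phi t x s v) u (du phi t x u v).
Proof.
  intro H. exact (is_derive_partial _ (Cd U 0 0) (fun k => match k with Ct => t | Cx => x
     | Cd U _ _ => u | _ => v end) u H).
Qed.
Lemma is_derive_dv phi t x u v : smooth (on_jets phi) ->
  is_derive (fun s => phi t x u s) v (dv phi t x u v).
Proof.
  intro H. exact (is_derive_partial _ (Cd V 0 0) (fun k => match k with Ct => t | Cx => x
     | Cd U _ _ => u | _ => v end) v H).
Qed.

Lemma constant_slope_affine (f f' : R -> R) k :
  (forall s, is_derive f s (f' s)) -> (forall s, f' s = k) -> forall s, f s = k * s + f 0.
Proof.
  intros D K s.
  destruct (MVT_gen f 0 s f') as [r [_ E]].
  - intros r _; apply D.
  - intros r _. apply continuity_pt_filterlim, (ex_derive_continuous f). now exists (f' r).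
  - rewrite K in E. lra.
Qed.

Lemma constant_of_derive_zero (f f' : R -> R) :
  (forall s, is_derive f s (f' s)) -> (forall s, f' s = 0) -> forall s, f s = f 0.
Proof. intros D K s. rewrite (constant_slope_affine f f' 0 D K s). ring. Qed.

Definition low_order_jet (t x u v ut vt ux vx uxx vxx : R) : jet :=
  fun k => match k with
  | Ct => t | Cx => x
  | Cd U 0 0 => u | Cd V 0 0 => v
  | Cd U 1 0 => ut | Cd V 1 0 => vt
  | Cd U 0 1 => ux | Cd V 0 1 => vx
  | Cd U 0 2 => uxx | Cd V 0 2 => vxx
  | _ => 0
  end.

(** In D_x^3 phi the coefficients of u_xx and v_xx are
    3 D_x(phi_u) and 3 D_x(phi_v) up to the order of mixed derivatives.  If both vanish
    for all u_x, v_x, then phi_u and phi_v depend on t alone.  The values [ut] and [vt]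
    do not enter D_x^3 phi; they are there for jets on which u_t and v_t are
    prescribed by evolution equations. *)
Lemma affine_of_D3 phi (ut vt : R -> R -> R -> R -> R) (B : R -> R -> R -> R -> R -> R -> R) :
  smooth (on_jets phi) ->
  (forall t x u v ux vx uxx vxx,
     D3 phi (low_order_jet t x u v (ut u v ux vx) (vt u v ux vx) ux vx uxx vxx) = B t x u v ux vx) ->
  exists (alpha beta : R -> R) (gamma : R -> R -> R), forall t x u v,
    phi t x u v = alpha t * u + beta t * v + gamma t x.
Proof.
  intros H E.
  assert (Hx := smooth_dx _ H). assert (Hu := smooth_du _ H). assert (Hv := smooth_dv _ H).
  assert (K : forall t x u v ux vx,
     (du (dx phi) t x u v + du (du phi) t x u v * ux + du (dv phi) t x u v * vx
     + 2 * (dx (du phi) t x u v + du (du phi) t x u v * ux + dv (du phi) t x u v * vx) = 0) /\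
     (dv (dx phi) t x u v + dv (du phi) t x u v * ux + dv (dv phi) t x u v * vx
     + 2 * (dx (dv phi) t x u v + du (dv phi) t x u v * ux + dv (dv phi) t x u v * vx) = 0)).
  { intros t x u v ux vx.
    assert (E00 := E t x u v ux vx 0 0).
    assert (E10 := E t x u v ux vx 1 0).
    assert (E01 := E t x u v ux vx 0 1).
    unfold D3, D2, D1, on_jets in E00, E10, E01. cbn [low_order_jet] in E00, E10, E01. lra. }
  (* The ux and vx coefficients of K are 3 phi_uu, 3 phi_vv, and two independent
     combinations of phi_uv and phi_vu. *)
  assert (Kuu : forall t x u v, du (du phi) t x u v = 0).
  { intros t x u v. destruct (K t x u v 0 0), (K t x u v 1 0). lra. }
  assert (Kvv : forall t x u v, dv (dv phi) t x u v = 0).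
  { intros t x u v. destruct (K t x u v 0 0), (K t x u v 0 1). lra. }
  assert (Kuv : forall t x u v, dv (du phi) t x u v = 0).
  { intros t x u v. destruct (K t x u v 0 0), (K t x u v 1 0), (K t x u v 0 1). lra. }
  assert (Kvu : forall t x u v, du (dv phi) t x u v = 0).
  { intros t x u v. destruct (K t x u v 0 0), (K t x u v 1 0), (K t x u v 0 1). lra. }
  assert (Cu : forall t x u v, du phi t x u v = du phi t x 0 0).
  { intros t x u v.
    rewrite (constant_of_derive_zero _ _ (fun s => is_derive_du _ t x s v Hu) (fun s => Kuu t x s v)).
    exact (constant_of_derive_zero _ _ (fun s => is_derive_dv _ t x 0 s Hu) (fun s => Kuv t x 0 s) v). }
  assert (Cv : forall t x u v, dv phi t x u v = dv phi t x 0 0).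
  { intros t x u v.
    rewrite (constant_of_derive_zero _ _ (fun s => is_derive_du _ t x s v Hv) (fun s => Kvu t x s v)).
    exact (constant_of_derive_zero _ _ (fun s => is_derive_dv _ t x 0 s Hv) (fun s => Kvv t x 0 s) v). }
  assert (A : forall t x u v, phi t x u v = du phi t x 0 0 * u + dv phi t x 0 0 * v + phi t x 0 0).
  { intros t x u v.
    rewrite (constant_slope_affine _ _ _ (fun s => is_derive_du _ t x s v H) (fun s => Cu t x s v)).
    rewrite (constant_slope_affine _ _ _ (fun s => is_derive_dv _ t x 0 s H) (fun s => Cv t x 0 s)).
    ring. }
  assert (Ax : forall t x u v, dx phi t x u v =
     dx (du phi) t x 0 0 * u + dx (dv phi) t x 0 0 * v + dx phi t x 0 0).
  { intros t x u v. apply is_derive_unique.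
    apply (is_derive_ext (fun s => du phi t s 0 0 * u + dv phi t s 0 0 * v + phi t s 0 0)).
    - intro s. now rewrite <- A.
    - assert (D1 := is_derive_dx _ t x 0 0 Hu). assert (D2 := is_derive_dx _ t x 0 0 Hv).
      assert (D3 := is_derive_dx _ t x 0 0 H).
      exact (is_derive_plus _ _ _ _ _ (is_derive_plus _ _ _ _ _
        (is_derive_scal_l _ _ _ u D1) (is_derive_scal_l _ _ _ v D2)) D3). }
  (* Once phi is affine in u, v, the mixed derivatives agree, and the constant term
     of K becomes 3 times the x-derivative of the slope. *)
  assert (Zu : forall t x, dx (du phi) t x 0 0 = 0).
  { intros t x. destruct (K t x 0 0 0 0) as [K1 _].
    assert (Dux : du (dx phi) t x 0 0 = dx (du phi) t x 0 0).
    { apply is_derive_unique. eapply is_derive_ext; [intro s; symmetry; apply Ax |].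
      auto_derive; [easy | ring]. }
    lra. }
  assert (Zv : forall t x, dx (dv phi) t x 0 0 = 0).
  { intros t x. destruct (K t x 0 0 0 0) as [_ K1].
    assert (Dvx : dv (dx phi) t x 0 0 = dx (dv phi) t x 0 0).
    { apply is_derive_unique. eapply is_derive_ext; [intro s; symmetry; apply Ax |].
      auto_derive; [easy | ring]. }
    lra. }
  exists (fun t => du phi t 0 0 0), (fun t => dv phi t 0 0 0), (fun t x => phi t x 0 0).
  intros t x u v. rewrite A.
  rewrite (constant_of_derive_zero _ _ (fun s => is_derive_dx _ t s 0 0 Hu) (fun s => Zu t s)).
  now rewrite (constant_of_derive_zero _ _ (fun s => is_derive_dx _ t s 0 0 Hv) (fun s => Zv t s)).
Qed.

Definition affine_in_uv (alpha beta : R -> R) (gamma : R -> R -> R) t x u v :=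
  alpha t * u + beta t * v + gamma t x.

Lemma du_tx (h : R -> R -> R) : du (fun t x _ _ => h t x) = fun _ _ _ _ => 0.
Proof. repeat (apply functional_extensionality; intro). exact (Derive_const _ _). Qed.
Lemma dv_tx (h : R -> R -> R) : dv (fun t x _ _ => h t x) = fun _ _ _ _ => 0.
Proof. repeat (apply functional_extensionality; intro). exact (Derive_const _ _). Qed.
Lemma D1_tx (h : R -> R -> R) z : D1 (fun t x _ _ => h t x) z = Derive (h (z Ct)) (z Cx).
Proof. unfold D1. rewrite du_tx, dv_tx. unfold on_jets. now rewrite !Rmult_0_l, !Rplus_0_r. Qed.
Lemma D2_tx (h : R -> R -> R) z : D2 (fun t x _ _ => h t x) z = Derive_n (h (z Ct)) 2 (z Cx).
Proof.
  unfold D2. rewrite du_tx, dv_tx, (D1_tx (fun t x => Derive (h t) x)), (D1_tx (fun _ _ => 0)).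
  rewrite Derive_const. unfold on_jets. now rewrite !Rmult_0_l, !Rplus_0_r.
Qed.

Section Affine.
Variables (alpha beta : R -> R) (gamma : R -> R -> R).
Notation phi := (affine_in_uv alpha beta gamma).
Hypothesis H : smooth (on_jets phi).

Lemma affine_derive_gamma_t t x : is_derive (fun s => gamma s x) t (dt phi t x 0 0).
Proof.
  eapply is_derive_ext; [| apply is_derive_dt, H]. intro s; unfold affine_in_uv; simpl; ring.
Qed.
Lemma affine_derive_gamma_x t x : is_derive (gamma t) x (dx phi t x 0 0).
Proof.
  eapply is_derive_ext; [| apply is_derive_dx, H]. intro s; unfold affine_in_uv; simpl; ring.
Qed.
Lemma affine_derive_alpha t : is_derive alpha t (dt phi t 0 1 0 - dt phi t 0 0 0).
Proof.
  eapply is_derive_ext; [| refine (is_derive_minus _ _ _ _ _ (is_derive_dt _ t 0 1 0 H) (is_derive_dt _ t 0 0 0 H))].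
  intro s; unfold affine_in_uv, minus, plus, opp; simpl; ring.
Qed.
Lemma affine_derive_beta t : is_derive beta t (dt phi t 0 0 1 - dt phi t 0 0 0).
Proof.
  eapply is_derive_ext; [| refine (is_derive_minus _ _ _ _ _ (is_derive_dt _ t 0 0 1 H) (is_derive_dt _ t 0 0 0 H))].
  intro s; unfold affine_in_uv, minus, plus, opp; simpl; ring.
Qed.

Lemma du_affine : du phi = fun t x u v => alpha t.
Proof.
  repeat (apply functional_extensionality; intro). apply is_derive_unique. unfold affine_in_uv.
  auto_derive; [easy | ring].
Qed.
Lemma dv_affine : dv phi = fun t x u v => beta t.
Proof.
  repeat (apply functional_extensionality; intro). apply is_derive_unique. unfold affine_in_uv.
  auto_derive; [easy | ring].
Qed.
Lemma dx_affine : dx phi = fun t x u v => Derive (gamma t) x.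
Proof.
  apply functional_extensionality; intro t; apply functional_extensionality; intro x;
  apply functional_extensionality; intro u; apply functional_extensionality; intro v.
  apply is_derive_unique. unfold affine_in_uv.
  auto_derive; [| apply Rmult_1_l]. eexists; apply affine_derive_gamma_x.
Qed.
Lemma dt_affine t x u v : dt phi t x u v =
  Derive alpha t * u + Derive beta t * v + Derive (fun s => gamma s x) t.
Proof.
  assert (Da := Derive_correct _ _ (ex_intro _ _ (affine_derive_alpha t))).
  assert (Db := Derive_correct _ _ (ex_intro _ _ (affine_derive_beta t))).
  assert (Dg := Derive_correct _ _ (ex_intro _ _ (affine_derive_gamma_t t x))).
  exact (is_derive_unique _ _ _ (is_derive_plus _ _ _ _ _ (is_derive_plus _ _ _ _ _
    (is_derive_scal_l _ _ _ u Da) (is_derive_scal_l _ _ _ v Db)) Dg)).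
Qed.

Lemma D1_affine z : D1 phi z = Derive (gamma (z Ct)) (z Cx)
  + alpha (z Ct) * z (Cd U 0 1) + beta (z Ct) * z (Cd V 0 1).
Proof. unfold D1. now rewrite du_affine, dv_affine, dx_affine. Qed.

Lemma D3_affine z : D3 phi z = Derive_n (gamma (z Ct)) 3 (z Cx)
  + alpha (z Ct) * z (Cd U 0 3) + beta (z Ct) * z (Cd V 0 3).
Proof.
  unfold D3. rewrite du_affine, dv_affine, dx_affine.
  rewrite (D2_tx (fun t x => Derive (gamma t) x)), (D2_tx (fun t _ => alpha t)),
    (D2_tx (fun t _ => beta t)), (D1_tx (fun t _ => alpha t)), (D1_tx (fun t _ => beta t)).
  simpl. rewrite Derive_const, Derive_const.
  rewrite (Derive_ext (Derive (fun _ => alpha (z Ct))) (fun _ => 0)) by (intro; apply Derive_const).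
  rewrite (Derive_ext (Derive (fun _ => beta (z Ct))) (fun _ => 0)) by (intro; apply Derive_const).
  rewrite Derive_const. unfold on_jets.
  rewrite !Rmult_0_l, !Rmult_0_r, !Rplus_0_l, !Rmult_0_l, !Rplus_0_l. reflexivity.
Qed.

End Affine.

(** * Exchanging u and v *)

Definition swap_dvar w := match w with U => V | V => U | Ubar => Vbar | Vbar => Ubar end.
Definition swap (z : jet) : jet :=
  fun k => match k with Cd w i j => z (Cd (swap_dvar w) i j) | _ => z k end.

Lemma swap_swap z : swap (swap z) = z.
Proof. apply functional_extensionality; now intros [| | [] i j]. Qed.

Lemma TDx_swap F : TDx (fun z => F (swap z)) = fun z => TDx F (swap z).
Proof.
  apply functional_extensionality; intro z. apply Derive_ext; intro s.
  f_equal. apply functional_extensionality; now intros [| | [] i j].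
Qed.

Lemma TDt_swap F : TDt (fun z => F (swap z)) = fun z => TDt F (swap z).
Proof.
  apply functional_extensionality; intro z. apply Derive_ext; intro s.
  f_equal. apply functional_extensionality; now intros [| | [] i j].
Qed.

Lemma TDtx_swap i j F : TDtx i j (fun z => F (swap z)) = fun z => TDtx i j F (swap z).
Proof.
  unfold TDtx.
  assert (Ex : Nat.iter j TDx (fun z => F (swap z)) = fun z => Nat.iter j TDx F (swap z)).
  { induction j as [|j IH]; [easy | rewrite !Nat.iter_succ, IH; apply TDx_swap]. }
  rewrite Ex.
  induction i as [|i IH]; [easy | rewrite !Nat.iter_succ, IH; apply TDt_swap].
Qed.

Lemma partial_swap w i j F :
  partial (Cd w i j) (fun z => F (swap z)) = fun z => partial (Cd (swap_dvar w) i j) F (swap z).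
Proof.
  apply functional_extensionality; intro z. unfold partial.
  replace (swap z (Cd (swap_dvar w) i j)) with (z (Cd w i j)) by now destruct w.
  apply Derive_ext; intro s. f_equal.
  apply functional_extensionality; intros [| | w' i' j']; [easy .. |].
  unfold swap, upd.
  destruct (coord_eq_dec (Cd (swap_dvar w') i' j') (Cd w i j)) as [E|N],
    (coord_eq_dec (Cd w' i' j') (Cd (swap_dvar w) i j)) as [E'|N']; try easy.
  - contradict N'. injection E as <- <- <-. now destruct w'.
  - contradict N. injection E' as -> -> ->. now destruct w.
Qed.

Lemma euler_swap m w L : (forall z, L (swap z) = L z) ->
  forall z, euler m (swap_dvar w) L z = euler m w L (swap z).
Proof.
  intros HL z. unfold euler.
  apply sum_eq; intros k _. apply sum_eq; intros i _. f_equal.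
  replace L with (fun z => L (swap z)) at 1 by (now apply functional_extensionality).
  rewrite partial_swap, TDtx_swap. now destruct w.
Qed.

(** * The system and its adjoint *)

Section System.
Variables (a b c : R) (n : nat).

(** [flux1] and [flux2] are the derivatives f_u and f_v of the first flux, with
    p = n + 1.  As g(u,v) = f(v,u), the derivatives of the second flux are
    g_u(u,v) = flux2 v u and g_v(u,v) = flux1 v u. *)
Definition flux1 u v := a * ((INR n + 2) * (u * u ^ n) + v * v ^ n)
  + b * ((INR n + 1) * (u ^ n * v ^ n * v ^ 2)).
Definition flux2 u v := a * ((INR n + 1) * (u * v ^ n))
  + b * ((INR n + 2) * (u * u ^ n * (v * v ^ n))).

Notation F1 := (eqF1 a b c (S n)).
Notation F2 := (eqF2 a b c (S n)).

Lemma eqF1_expand : F1 = fun z : jet =>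
  z (Cd U 1 0) + (flux1 (z (Cd U 0 0)) (z (Cd V 0 0)) * z (Cd U 0 1)
  + flux2 (z (Cd U 0 0)) (z (Cd V 0 0)) * z (Cd V 0 1)) + c * z (Cd U 0 3).
Proof.
  apply functional_extensionality; intro z. unfold eqF1.
  evar (d1 : R). evar (d2 : R).
  replace (TDx (fun y => (y (Cd U 0 0) ^ S n + y (Cd V 0 0) ^ S n) * y (Cd U 0 0)) z) with d1.
  2:{ symmetry; apply is_derive_unique; unfold d1; auto_derive; [easy | reflexivity]. }
  replace (TDx (fun y => (y (Cd U 0 0) * y (Cd V 0 0)) ^ S n * y (Cd V 0 0)) z) with d2.
  2:{ symmetry; apply is_derive_unique; unfold d2; auto_derive; [easy | reflexivity]. }
  unfold d1, d2, flux1, flux2. cbn [Nat.pred shift_x].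
  change (match n with O => 1 | S _ => INR n + 1 end) with (INR (S n)).
  rewrite ?Rmult_0_l, ?Rplus_0_r, ?S_INR, ?Rpow_mult_distr.
  simpl pow. ring.
Qed.

Lemma eqF2_swap : F2 = fun z => F1 (swap z).
Proof.
  apply functional_extensionality; intro z. unfold eqF1, eqF2.
  assert (T : forall G G', (forall y, G y = G' (swap y)) -> TDx G z = TDx G' (swap z)).
  { intros G G' E. now rewrite (functional_extensionality _ _ E), TDx_swap. }
  rewrite (T _ (fun y => (y (Cd U 0 0) ^ S n + y (Cd V 0 0) ^ S n) * y (Cd U 0 0)))
    by (intro y; simpl; ring).
  rewrite (T _ (fun y => (y (Cd U 0 0) * y (Cd V 0 0)) ^ S n * y (Cd V 0 0)))
    by (intro y; simpl swap; now rewrite (Rmult_comm (y (Cd V 0 0)))).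
  reflexivity.
Qed.

Lemma eqF2_expand : F2 = fun z : jet =>
  z (Cd V 1 0) + (flux1 (z (Cd V 0 0)) (z (Cd U 0 0)) * z (Cd V 0 1)
  + flux2 (z (Cd V 0 0)) (z (Cd U 0 0)) * z (Cd U 0 1)) + c * z (Cd V 0 3).
Proof. now rewrite eqF2_swap, eqF1_expand. Qed.

Lemma TDx_zero : TDx (fun _ => 0) = fun _ => 0.
Proof. apply functional_extensionality; intro z. exact (Derive_const 0 0). Qed.
Lemma TDt_zero : TDt (fun _ => 0) = fun _ => 0.
Proof. apply functional_extensionality; intro z. exact (Derive_const 0 0). Qed.
Lemma iter_fixed (A : Type) (f : A -> A) x k : f x = x -> Nat.iter k f x = x.
Proof. intro E. induction k as [|k IH]; [easy | now rewrite Nat.iter_succ, IH]. Qed.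

Lemma TDtx_zero i j : TDtx i j (fun _ => 0) = fun _ => 0.
Proof.
  unfold TDtx. rewrite (iter_fixed _ TDx) by apply TDx_zero. apply iter_fixed, TDt_zero.
Qed.

Notation L := (formal_lagrangian F1 F2).

Lemma TDx_coord k w i j : TDx (fun z => k * z (Cd w i j)) = fun z => k * z (Cd w i (S j)).
Proof.
  apply functional_extensionality; intro z. apply is_derive_unique. simpl.
  auto_derive; [easy | ring].
Qed.

Ltac compute_partial :=
  apply functional_extensionality; intro z;
  unfold partial, formal_lagrangian; rewrite eqF1_expand, eqF2_expand;
  apply is_derive_unique; unfold upd, flux1, flux2; simpl coord_eq_dec; cbv iota;
  auto_derive; [easy | ].

Lemma lagrangian_ux : partial (Cd U 0 1) L = fun z => z (Cd Ubar 0 0) * flux1 (z (Cd U 0 0)) (z (Cd V 0 0))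
    + z (Cd Vbar 0 0) * flux2 (z (Cd V 0 0)) (z (Cd U 0 0)).
Proof. compute_partial. unfold flux1, flux2. ring. Qed.
Lemma lagrangian_ut : partial (Cd U 1 0) L = fun z => z (Cd Ubar 0 0).
Proof. compute_partial. ring. Qed.
Lemma lagrangian_uxxx : partial (Cd U 0 3) L = fun z => c * z (Cd Ubar 0 0).
Proof. compute_partial. ring. Qed.

(** The factor of ubar in the Lagrangian is u_t + D_x f + c u_xxx, and the derivative
    with respect to u commutes with D_x, while (D_x f)_{u_x} = f_u; hence the two sides
    differ by D_x of ubar and vbar only. *)
Lemma lagrangian_u : partial (Cd U 0 0) L = fun z => TDx (partial (Cd U 0 1) L) z
  - z (Cd Ubar 0 1) * flux1 (z (Cd U 0 0)) (z (Cd V 0 0))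
    - z (Cd Vbar 0 1) * flux2 (z (Cd V 0 0)) (z (Cd U 0 0)).
Proof.
  rewrite lagrangian_ux. compute_partial. evar (d : R).
  match goal with |- _ = TDx ?G z - _ - _ => replace (TDx G z) with d end.
  2:{ symmetry; apply is_derive_unique; unfold d, flux1, flux2; auto_derive; [easy | reflexivity]. }
  unfold d, flux1, flux2; clear d; cbn [Nat.pred shift_x].
  rewrite !Rmult_0_l, !Rplus_0_r.
  (* the derivative of u ^ n involves u ^ (n - 1), absent for n = 0 *)
  destruct n as [|m]; [simpl; ring | rewrite S_INR; simpl; ring].
Qed.

Lemma lagrangian_other_derivatives i j :
  List.In (i, j) ((2,0)::(1,1)::(0,2)::(3,0)::(2,1)::(1,2)::nil)%nat ->
  partial (Cd U i j) L = fun _ => 0.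
Proof.
  intro H.
  repeat (destruct H as [E|H]; [injection E as <- <-; compute_partial; ring | ]). easy.
Qed.

Lemma adjointU z : adjoint 3 U F1 F2 z =
   z (Cd Ubar 1 0) + flux1 (z (Cd U 0 0)) (z (Cd V 0 0)) * z (Cd Ubar 0 1)
    + flux2 (z (Cd V 0 0)) (z (Cd U 0 0)) * z (Cd Vbar 0 1)
    + c * z (Cd Ubar 0 3).
Proof.
  unfold adjoint, euler. cbn [sum_f_R0 Nat.sub].
  rewrite (lagrangian_other_derivatives 2 0), (lagrangian_other_derivatives 1 1), (lagrangian_other_derivatives 0 2), (lagrangian_other_derivatives 3 0), (lagrangian_other_derivatives 2 1), (lagrangian_other_derivatives 1 2)
    by (simpl; tauto). rewrite !TDtx_zero.
  rewrite lagrangian_ut, lagrangian_u, lagrangian_uxxx.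
  assert (E10 : TDtx 1 0 (fun z => z (Cd Ubar 0 0)) z = z (Cd Ubar 1 0)).
  { apply is_derive_unique; simpl; auto_derive; [easy | ring]. }
  assert (E03 : TDtx 0 3 (fun z => c * z (Cd Ubar 0 0)) z = c * z (Cd Ubar 0 3)).
  { unfold TDtx; simpl. now rewrite !TDx_coord. }
  rewrite E10, E03. unfold TDtx; simpl. ring.
Qed.

Lemma adjointV z : adjoint 3 V F1 F2 z = adjoint 3 U F1 F2 (swap z).
Proof.
  unfold adjoint. f_equal. apply (euler_swap 3 U).
  intro y. unfold formal_lagrangian. rewrite eqF2_swap. rewrite swap_swap. simpl. ring.
Qed.

Lemma adjointU_substitute phi psi z : smooth (on_jets phi) -> smooth (on_jets psi) ->
  adjoint 3 U F1 F2 (substitute phi psi z) =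
  on_jets (dt phi) z + on_jets (du phi) z * z (Cd U 1 0) + on_jets (dv phi) z * z (Cd V 1 0)
  + flux1 (z (Cd U 0 0)) (z (Cd V 0 0)) * D1 phi z
  + flux2 (z (Cd V 0 0)) (z (Cd U 0 0)) * D1 psi z
  + c * D3 phi z.
Proof.
  intros Hphi Hpsi. rewrite adjointU. cbn [substitute].
  now rewrite TDt_chain_rule, !TDx_eq_D1, TDx3_eq_D3.
Qed.

Lemma adjointV_substitute phi psi z : smooth (on_jets phi) -> smooth (on_jets psi) ->
  adjoint 3 V F1 F2 (substitute phi psi z) =
  on_jets (dt psi) z + on_jets (du psi) z * z (Cd U 1 0) + on_jets (dv psi) z * z (Cd V 1 0)
  + flux1 (z (Cd V 0 0)) (z (Cd U 0 0)) * D1 psi z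
  + flux2 (z (Cd U 0 0)) (z (Cd V 0 0)) * D1 phi z
  + c * D3 psi z.
Proof.
  intros Hphi Hpsi. rewrite adjointV, adjointU. cbn [substitute swap swap_dvar].
  now rewrite TDt_chain_rule, !TDx_eq_D1, TDx3_eq_D3.
Qed.

(** The jets of solutions that test the adjoint equations: the third derivatives
    vanish, and F1 = F2 = 0 is solved for u_t and v_t. *)
Definition solution_jet t x u v ux vx uxx vxx :=
  low_order_jet t x u v (- (flux1 u v * ux + flux2 u v * vx)) (- (flux1 v u * vx + flux2 v u * ux)) ux vx uxx vxx.

Lemma F1_solution_jet t x u v ux vx uxx vxx : F1 (solution_jet t x u v ux vx uxx vxx) = 0.
Proof. rewrite eqF1_expand. unfold solution_jet; cbn [low_order_jet]. ring. Qed.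
Lemma F2_solution_jet t x u v ux vx uxx vxx : F2 (solution_jet t x u v ux vx uxx vxx) = 0.
Proof. rewrite eqF2_expand. unfold solution_jet; cbn [low_order_jet]. ring. Qed.

(** Symmetry of the product of ((alpha, beta), (beta, alpha)) with the Jacobian matrix
    ((f_u, f_v), (g_u, g_v)). *)
Definition symmetrizes_jacobian alpha beta := forall u v,
   alpha * (flux2 v u - flux2 u v) + beta * (flux1 u v - flux1 v u) = 0.

(** The part of the adjoint equation free of derivatives of u and v, for
    phi = alpha u + beta v + gamma and psi = beta u + alpha v + sigma. *)
Definition no_flux_residue (alpha beta : R -> R) (gamma sigma : R -> R -> R) := forall t x u v,
  Derive alpha t * u + Derive beta t * v + Derive (fun s => gamma s x) t
  + flux1 u v * Derive (gamma t) x + flux2 v u * Derive (sigma t) x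
  + c * Derive_n (gamma t) 3 x = 0.

(** The multipliers are the slopes: in adjoint - (alpha F1 + beta F2) the derivatives
    of highest order cancel, v_x is multiplied by the defect of symmetry, u_x cancels,
    and what remains is the residue.  In the second equation u_x and v_x change roles. *)
Lemma substitution_of_determining alpha beta gamma sigma :
  smooth (fun z => alpha (z Ct)) -> smooth (fun z => beta (z Ct)) ->
  smooth (on_jets (affine_in_uv alpha beta gamma)) ->
  smooth (on_jets (affine_in_uv beta alpha sigma)) ->
  not_both_zero (affine_in_uv alpha beta gamma) (affine_in_uv beta alpha sigma) ->
  (forall t, symmetrizes_jacobian (alpha t) (beta t)) ->
  no_flux_residue alpha beta gamma sigma ->
  no_flux_residue alpha beta sigma gamma ->
  is_substitution 3 F1 F2 (affine_in_uv alpha beta gamma) (affine_in_uv beta alpha sigma).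
Proof.
  intros Ha Hb Hphi Hpsi Hnz HS H1 H2.
  assert (cf : forall h : R -> R, smooth (fun z => h (z Ct)) -> coefficient_function (fun z => h (z Ct))).
  { intros h Hh. split; [easy |]. exists O. intros z z' Et _ _. now rewrite Et. }
  split; [easy |]. split; [easy |]. split; [easy |].
  exists (fun z => alpha (z Ct)), (fun z => beta (z Ct)), (fun z => beta (z Ct)), (fun z => alpha (z Ct)).
  repeat (split; [now apply cf |]).
  intro z. rewrite adjointU_substitute, adjointV_substitute by easy.
  rewrite !D1_affine, !D3_affine, eqF1_expand, eqF2_expand, !du_affine, !dv_affine by easy.
  unfold on_jets. rewrite !dt_affine by easy.
  specialize (HS (z Ct) (z (Cd U 0 0)) (z (Cd V 0 0))).
  split.
  - generalize (H1 (z Ct) (z Cx) (z (Cd U 0 0)) (z (Cd V 0 0))).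
    intro E. apply Rminus_diag_uniq.
    match type of E with ?e = _ => match type of HS with ?h = _ =>
      transitivity (e + z (Cd V 0 1) * h); [ring | rewrite E, HS; ring] end end.
  - generalize (H2 (z Ct) (z Cx) (z (Cd V 0 0)) (z (Cd U 0 0))).
    intro E. apply Rminus_diag_uniq.
    match type of E with ?e = _ => match type of HS with ?h = _ =>
      transitivity (e - z (Cd U 0 1) * h); [ring | rewrite E, HS; ring] end end.
Qed.

(** * The three families are substitutions *)

Definition diagonal_case := a = 0 \/ n = 1%nat.
Definition sum_case := b = 0 /\ n = 0%nat.

Lemma Derive_n_3_constant_slope f k x : (forall s, Derive f s = k) -> Derive_n f 3 x = 0.
Proof.
  intro E. simpl. rewrite (Derive_ext _ (fun _ => 0)); [apply Derive_const |].
  intro r. rewrite (Derive_ext _ (fun _ => k)); [apply Derive_const | apply E].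
Qed.

Ltac polynomial_smooth :=
  apply jet_polynomial_smooth; unfold on_jets, affine_in_uv; repeat constructor.

Lemma diagonal_substitution c3 c4 c5 phi psi : diagonal_case \/ c3 = 0 ->
  not_both_zero phi psi ->
  (forall t x u v, phi t x u v = c3 * u + c4 /\ psi t x u v = c3 * v + c5) ->
  is_substitution 3 F1 F2 phi psi.
Proof.
  intros HD Hnz E.
  assert (E1 : phi = affine_in_uv (fun _ => c3) (fun _ => 0) (fun _ _ => c4)).
  { repeat (apply functional_extensionality; intro). unfold affine_in_uv. rewrite (proj1 (E _ _ _ _)). ring. }
  assert (E2 : psi = affine_in_uv (fun _ => 0) (fun _ => c3) (fun _ _ => c5)).
  { repeat (apply functional_extensionality; intro). unfold affine_in_uv. rewrite (proj2 (E _ _ _ _)). ring. }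
  subst phi psi.
  assert (R : forall k1 k2, no_flux_residue (fun _ => c3) (fun _ => 0) (fun _ _ => k1) (fun _ _ => k2)).
  { intros k1 k2 t x u v. rewrite (Derive_n_3_constant_slope _ 0) by (intro; apply Derive_const).
    cbv beta. rewrite !Derive_const. ring. }
  apply substitution_of_determining; try polynomial_smooth; try easy; try apply R.
  intros _ u v. unfold flux1, flux2. destruct HD as [[-> | ->] | ->]; simpl; ring.
Qed.

Lemma sum_substitution c1 c2 c4 c5 phi psi : sum_case ->
  not_both_zero phi psi ->
  (forall t x u v, phi t x u v = (2 * a * c1 * t + c2) * (v + u) - c1 * x + c4 /\
                   psi t x u v = (2 * a * c1 * t + c2) * (v + u) - c1 * x + c5) ->
  is_substitution 3 F1 F2 phi psi.
Proof.
  intros [Hb Hn] Hnz E.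
  set (al := fun t => 2 * a * c1 * t + c2).
  set (ga := fun k (t x : R) => - c1 * x + k).
  assert (E1 : phi = affine_in_uv al al (ga c4)).
  { repeat (apply functional_extensionality; intro). unfold affine_in_uv, al, ga. rewrite (proj1 (E _ _ _ _)). ring. }
  assert (E2 : psi = affine_in_uv al al (ga c5)).
  { repeat (apply functional_extensionality; intro). unfold affine_in_uv, al, ga. rewrite (proj2 (E _ _ _ _)). ring. }
  subst phi psi.
  assert (Da : forall t, Derive al t = 2 * a * c1).
  { intro t. apply is_derive_unique. unfold al. auto_derive; [easy | ring]. }
  assert (Dx : forall k t x, Derive (ga k t) x = - c1).
  { intros k t x. apply is_derive_unique. unfold ga. auto_derive; [easy | ring]. }
  assert (D3x : forall k t x, Derive_n (ga k t) 3 x = 0).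
  { intros k t x. exact (Derive_n_3_constant_slope _ _ _ (Dx k t)). }
  assert (R : forall k1 k2, no_flux_residue al al (ga k1) (ga k2)).
  { intros k1 k2 t x u v. rewrite Da, !Dx, D3x. unfold ga. rewrite Derive_const.
    unfold flux1, flux2. rewrite Hb, Hn. simpl. ring. }
  apply substitution_of_determining; try (unfold al, ga; polynomial_smooth); try easy; try apply R.
  intros t u v. unfold flux1, flux2. rewrite Hb, Hn. simpl. ring.
Qed.

(** * Algebra of the fluxes *)

Hypothesis hc : c <> 0.
Hypothesis hab : ~ (a = 0 /\ b = 0).

(** [fluxA1], [fluxA2] (factor a, homogeneous of degree p) and [fluxB1], [fluxB2]
    (factor b, homogeneous of degree 2p) are the homogeneous parts of [flux1], [flux2]. *)
Definition fluxA1 u v := (INR n + 2) * (u * u ^ n) + v * v ^ n.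
Definition fluxB1 u v := (INR n + 1) * (u ^ n * v ^ n * v ^ 2).
Definition fluxA2 u v := (INR n + 1) * (u * v ^ n).
Definition fluxB2 u v := (INR n + 2) * (u * u ^ n * (v * v ^ n)).

(** Doubling (u, v) multiplies the two parts by k = 2^p and k^2, which are different,
    so a relation between the fluxes holds for both parts separately. *)
Lemma flux_split X Y Z W :
  (forall u v, X * flux1 u v + Y * flux2 v u + Z * flux2 u v + W * flux1 v u = 0) ->
  forall u v,
  a * (X * fluxA1 u v + Y * fluxA2 v u + Z * fluxA2 u v + W * fluxA1 v u) = 0 /\
  b * (X * fluxB1 u v + Y * fluxB2 v u + Z * fluxB2 u v + W * fluxB1 v u) = 0.
Proof.
  intros E u v.
  assert (E1 := E u v). assert (E2 := E (2 * u) (2 * v)).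
  set (A := a * _). set (B := b * _).
  assert (K : 1 <= 2 ^ n) by (apply pow_R1_Rle; lra).
  set (k := 2 * 2 ^ n).
  assert (EA : A + B = 0).
  { rewrite <- E1. unfold A, B, flux1, flux2, fluxA1, fluxA2, fluxB1, fluxB2. ring. }
  assert (EB : k * A + k * k * B = 0).
  { rewrite <- E2. unfold k, A, B, flux1, flux2, fluxA1, fluxA2, fluxB1, fluxB2.
    rewrite !Rpow_mult_distr. ring. }
  assert (HB : k * (k - 1) * B = 0).
  { replace (k * (k - 1) * B) with ((k * A + k * k * B) - k * (A + B)) by ring.
    rewrite EA, EB; ring. }
  assert (B = 0).
  { destruct (Rmult_integral _ _ HB) as [H|H]; [| easy]. unfold k in H. nra. }
  lra.
Qed.

(** For a <> 0 the point (1, 0) isolates f_u and (1, 1) then detects g_u; for a = 0 the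
    points (1, 1) and (1, 2) give two independent equations. *)
Lemma flux_independent X Y : (forall u v, X * flux1 u v + Y * flux2 v u = 0) -> X = 0 /\ Y = 0.
Proof.
  intro E.
  assert (S := flux_split X Y 0 0 ltac:(intros u v; specialize (E u v); lra)).
  assert (N := pos_INR n).
  assert (T : 0 < 2 ^ n) by (apply pow_lt; lra).
  destruct (Req_dec a 0) as [Ea|Na].
  - assert (Nb : b <> 0) by tauto.
    destruct (S 1 1) as [_ S11]. destruct (S 1 2) as [_ S12].
    apply Rmult_integral in S11 as [|S11]; [easy |].
    apply Rmult_integral in S12 as [|S12]; [easy |].
    unfold fluxB1, fluxB2 in S11, S12. rewrite !pow1 in S11, S12.
    assert (X * (INR n + 1) = 0).
    { apply Rmult_eq_reg_l with (2 * 2 ^ n); [| lra].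
      apply (f_equal (Rmult (2 * 2 ^ n))) in S11. lra. }
    assert (X = 0) by nra. subst X. split; [easy |]. nra.
  - destruct (S 1 0) as [S10 _]. destruct (S 1 1) as [S11 _].
    apply Rmult_integral in S11 as [|S11]; [easy |].
    apply Rmult_integral in S10 as [|S10]; [easy |].
    unfold fluxA1, fluxA2 in S11, S10. rewrite !pow1 in S11, S10.
    assert (X = 0) by nra. subst X. split; [easy |]. nra.
Qed.

(** At (1, 1) the terms in beta cancel and delta - alpha survives.  If b <> 0, the
    b-part at (2, 1) gives beta = 0.  If a <> 0, the a-part at (1, 0) reads
    beta = alpha 0^n, that is beta = 0 for p > 1 and beta = alpha for p = 1; once
    beta = 0, the a-part at (2, 1) is proportional to alpha (2^n - 2) for n > 0, which
    vanishes identically only for n = 1, that is p = 2. *)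
Lemma symmetrizers_of_jacobian alpha beta delta :
  (forall u v, beta * flux1 u v + delta * flux2 v u + (- alpha) * flux2 u v + (- beta) * flux1 v u = 0) ->
  alpha = delta /\
  (~ sum_case -> beta = 0 /\ (~ diagonal_case -> alpha = 0)) /\
  (sum_case -> beta = alpha).
Proof.
  intro E. assert (S := flux_split _ _ _ _ E).
  assert (N := pos_INR n).
  assert (T : 0 < 2 ^ n) by (apply pow_lt; lra).
  assert (Ed : alpha = delta).
  { destruct (S 1 1) as [A11 B11]. unfold fluxA1, fluxA2, fluxB1, fluxB2 in *.
    rewrite !pow1 in A11, B11.
    apply Rmult_integral in A11 as [Ea|A11]; [| nra].
    apply Rmult_integral in B11 as [Eb|B11]; [tauto | nra]. }
  subst delta. split; [easy |].
  assert (Eb : b <> 0 -> beta = 0).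
  { intro Nb. destruct (S 2 1) as [_ B21]. unfold fluxB1, fluxB2 in B21. rewrite !pow1 in B21.
    apply Rmult_integral in B21 as [|B21]; [easy |].
    assert (K : 0 < (INR n + 1) * 2 ^ n) by nra. nra. }
  assert (Ea : a <> 0 -> beta = alpha * 0 ^ n).
  { intro Na. destruct (S 1 0) as [A10 _]. unfold fluxA1, fluxA2 in A10. rewrite !pow1 in A10.
    apply Rmult_integral in A10 as [|A10]; [easy |].
    assert (K : (INR n + 1) * (beta - alpha * 0 ^ n) = 0) by lra.
    apply Rmult_integral in K as [K|K]; lra. }
  split.
  - intro NS. assert (B0 : beta = 0).
    { destruct (Req_dec b 0) as [Zb|Nb]; [| auto].
      rewrite Ea by tauto. rewrite pow_i; [ring |]. unfold sum_case in NS. assert (n <> O) by tauto. lia. }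
    split; [easy |]. intro ND. unfold diagonal_case in ND.
    assert (Na : a <> 0) by tauto.
    destruct (Nat.eq_dec n 0) as [En|Nn].
    + rewrite Ea, En in B0 by easy. simpl in B0. lra.
    + destruct (S 2 1) as [A21 _]. unfold fluxA1, fluxA2 in A21. rewrite !pow1, B0 in A21.
      apply Rmult_integral in A21 as [|A21]; [easy |].
      assert (K : 4 <= 2 ^ n).
      { replace 4 with (2 ^ 2) by ring. apply Rle_pow; [lra |]. assert (n <> 1%nat) by tauto. lia. }
      assert (Z : alpha * ((INR n + 1) * (2 ^ n - 2)) = 0) by lra.
      apply Rmult_integral in Z as [Z|Z]; [easy | nra].
  - intros [Zb En]. rewrite Ea by tauto. rewrite En. simpl. ring.
Qed.

(** * Necessity of the determining equations *)

(** On [solution_jet] the right-hand sides M F1 + N F2 and P F1 + Q F2 vanish, so that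
    the multipliers disappear and the coefficients of u_xx, v_xx, then u_x, v_x, then 1
    can be compared. *)
Lemma determining_of_substitution phi psi : is_substitution 3 F1 F2 phi psi ->
  exists alpha beta gamma sigma,
  phi = affine_in_uv alpha beta gamma /\ psi = affine_in_uv beta alpha sigma /\
  (forall t, (~ sum_case -> beta t = 0 /\ (~ diagonal_case -> alpha t = 0)) /\
  (sum_case -> beta t = alpha t)) /\
  no_flux_residue alpha beta gamma sigma /\ no_flux_residue alpha beta sigma gamma.
Proof.
  intros (Hphi & Hpsi & _ & M & N & P & Q & _ & _ & _ & _ & E).
  assert (E1 : forall t x u v ux vx uxx vxx,
    adjoint 3 U F1 F2 (substitute phi psi (solution_jet t x u v ux vx uxx vxx)) = 0).
  { intros. rewrite (proj1 (E _)), F1_solution_jet, F2_solution_jet. ring. }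
  assert (E2 : forall t x u v ux vx uxx vxx,
    adjoint 3 V F1 F2 (substitute phi psi (solution_jet t x u v ux vx uxx vxx)) = 0).
  { intros. rewrite (proj2 (E _)), F1_solution_jet, F2_solution_jet. ring. }
  clear E.
  (* [B] collects all terms without uxx and vxx. *)
  assert (A : forall chi B, smooth (on_jets chi) ->
     (forall t x u v ux vx uxx vxx, B t x u v ux vx + c * D3 chi (solution_jet t x u v ux vx uxx vxx) = 0) ->
     exists alpha beta gamma, chi = affine_in_uv alpha beta gamma).
  { intros chi B Hchi EB.
    destruct (affine_of_D3 chi (fun u v ux vx => - (flux1 u v * ux + flux2 u v * vx))
      (fun u v ux vx => - (flux1 v u * vx + flux2 v u * ux))
      (fun t x u v ux vx => - B t x u v ux vx / c) Hchi) as (al & be & ga & Ec).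
    { intros t x u v ux vx uxx vxx. specialize (EB t x u v ux vx uxx vxx). unfold solution_jet in EB.
      match type of EB with _ + c * ?d = 0 => transitivity d; [reflexivity | ];
        apply Rmult_eq_reg_l with c; [| easy]; transitivity (- B t x u v ux vx); [lra | field; easy] end. }
    exists al, be, ga. repeat (apply functional_extensionality; intro). apply Ec. }
  assert (A1 : exists al be ga, phi = affine_in_uv al be ga).
  { apply (A phi (fun t x u v ux vx => let z := solution_jet t x u v ux vx 0 0 in
      on_jets (dt phi) z + on_jets (du phi) z * z (Cd U 1 0) + on_jets (dv phi) z * z (Cd V 1 0)
      + flux1 u v * D1 phi z + flux2 v u * D1 psi z) Hphi).
    intros t x u v ux vx uxx vxx. etransitivity; [| apply (E1 t x u v ux vx uxx vxx)].
    rewrite adjointU_substitute by assumption. reflexivity. }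
  assert (A2 : exists al be ga, psi = affine_in_uv al be ga).
  { apply (A psi (fun t x u v ux vx => let z := solution_jet t x u v ux vx 0 0 in
      on_jets (dt psi) z + on_jets (du psi) z * z (Cd U 1 0) + on_jets (dv psi) z * z (Cd V 1 0)
      + flux1 v u * D1 psi z + flux2 u v * D1 phi z) Hpsi).
    intros t x u v ux vx uxx vxx. etransitivity; [| apply (E2 t x u v ux vx uxx vxx)].
    rewrite adjointV_substitute by assumption. reflexivity. }
  destruct A1 as (alpha & beta & gamma & ->). destruct A2 as (beta' & delta & sigma & ->).
  assert (G1 : forall t x u v ux vx,
    Derive alpha t * u + Derive beta t * v + Derive (fun s => gamma s x) t
    + alpha t * (- (flux1 u v * ux + flux2 u v * vx)) + beta t * (- (flux1 v u * vx + flux2 v u * ux))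
    + flux1 u v * (Derive (gamma t) x + alpha t * ux + beta t * vx)
    + flux2 v u * (Derive (sigma t) x + beta' t * ux + delta t * vx)
    + c * (Derive_n (gamma t) 3 x) = 0).
  { intros t x u v ux vx. etransitivity; [| apply (E1 t x u v ux vx 0 0)].
    rewrite adjointU_substitute, !D1_affine, D3_affine, du_affine, dv_affine by easy.
    unfold on_jets. rewrite dt_affine by easy. unfold solution_jet; cbn [low_order_jet]. ring. }
  assert (G2 : forall t x u v,
    Derive beta' t * u + Derive delta t * v + Derive (fun s => sigma s x) t
    + flux1 v u * (Derive (sigma t) x)
    + flux2 u v * (Derive (gamma t) x)
    + c * (Derive_n (sigma t) 3 x) = 0).
  { intros t x u v. etransitivity; [| apply (E2 t x u v 0 0 0 0)].
    rewrite adjointV_substitute, !D1_affine, D3_affine, du_affine, dv_affine by easy.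
    unfold on_jets. rewrite dt_affine by easy. unfold solution_jet; cbn [low_order_jet]. ring. }
  assert (Eb : beta' = beta).
  { apply functional_extensionality; intro t.
    apply Rminus_diag_uniq. apply (flux_independent 0). intros u v.
    generalize (G1 t 0 u v 1 0) (G1 t 0 u v 0 0). lra. }
  subst beta'.
  assert (S : forall t, alpha t = delta t /\ (~ sum_case -> beta t = 0 /\ (~ diagonal_case -> alpha t = 0)) /\
    (sum_case -> beta t = alpha t)).
  { intro t. apply symmetrizers_of_jacobian. intros u v.
    generalize (G1 t 0 u v 0 1) (G1 t 0 u v 0 0). lra. }
  assert (Ed : delta = alpha).
  { apply functional_extensionality; intro t. symmetry; apply S. }
  subst delta.
  exists alpha, beta, gamma, sigma.
  split; [easy |]. split; [easy |]. split; [apply S |]. split.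
  - intros t x u v. generalize (G1 t x u v 0 0). lra.
  - intros t x u v. generalize (G2 t x v u). lra.
Qed.

(** * Solving the determining equations *)

Lemma flux1_axis u : flux1 u 0 = a * ((INR n + 2) * (u * u ^ n) + 0).
Proof. unfold flux1. ring. Qed.
Lemma flux2_axis v : flux2 0 v = 0.
Proof. unfold flux2. ring. Qed.

(** All derivatives of the fluxes vanish at u = v = 0. *)
Lemma residue_at_rest alpha beta gamma sigma t x : no_flux_residue alpha beta gamma sigma ->
  Derive (fun s => gamma s x) t + c * Derive_n (gamma t) 3 x = 0.
Proof.
  intro E. specialize (E t x 0 0). rewrite flux1_axis, flux2_axis in E. lra.
Qed.

(** For a = 0 or p = 2 the derivatives of the fluxes take the same values at (1, 0) and
    (-1, 0), so the difference of the residues at these points is 2 alpha'. *)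
Lemma residue_diagonal alpha gamma sigma : diagonal_case ->
  no_flux_residue alpha (fun _ => 0) gamma sigma -> forall t, Derive alpha t = 0.
Proof.
  intros HD E t. generalize (E t 0 1 0) (E t 0 (-1) 0).
  rewrite !flux1_axis, !flux2_axis.
  destruct HD as [-> | ->]; simpl; lra.
Qed.

(** With constant slopes, independence of f_u and g_u gives gamma_x = 0, and then
    gamma_t = - c gamma_xxx = 0.  The regularity of gamma comes from
    the smooth affine function with slopes k1, k2: these are (alpha, beta) when gamma
    belongs to phi, and (beta, alpha) when it belongs to psi. *)
Lemma constant_remainder k1 k2 alpha beta gamma sigma :
  smooth (on_jets (affine_in_uv k1 k2 gamma)) ->
  (forall t, Derive alpha t = 0) -> (forall t, Derive beta t = 0) ->
  no_flux_residue alpha beta gamma sigma ->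
  forall t x, gamma t x = gamma 0 0.
Proof.
  intros Hphi Za Zb E t x.
  assert (R0 := fun t x => residue_at_rest _ _ _ _ t x E).
  assert (Gx : forall t x, Derive (gamma t) x = 0).
  { intros s y. apply (flux_independent _ (Derive (sigma s) y)). intros u v.
    generalize (E s y u v) (R0 s y). rewrite Za, Zb. lra. }
  assert (Gt : forall t x, Derive (fun s => gamma s x) t = 0).
  { intros s y. generalize (R0 s y). rewrite (Derive_n_3_constant_slope _ _ _ (Gx s)). lra. }
  transitivity (gamma 0 x).
  - refine (constant_of_derive_zero (fun s => gamma s x) _ (fun s => _) (fun s => Gt s x) t).
    eapply Derive_correct, ex_intro, affine_derive_gamma_t, Hphi.
  - refine (constant_of_derive_zero _ _ (fun s => _) (Gx 0) x).
    eapply Derive_correct, ex_intro, affine_derive_gamma_x, Hphi.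
Qed.

Lemma not_sum_classification phi psi : ~ sum_case -> is_substitution 3 F1 F2 phi psi ->
  exists c3 c4 c5, (~ diagonal_case -> c3 = 0) /\
  forall t x u v, phi t x u v = c3 * u + c4 /\ psi t x u v = c3 * v + c5.
Proof.
  intros NS H. assert (Hphi := proj1 H). assert (Hpsi := proj1 (proj2 H)).
  destruct (determining_of_substitution _ _ H) as (al & be & ga & si & -> & -> & S & R1 & R2).
  assert (Eb : be = fun _ => 0).
  { apply functional_extensionality; intro t. now apply S. }
  subst be.
  assert (Za : forall t, Derive al t = 0).
  { destruct (Req_dec a 0) as [Ea | Na]; [eapply residue_diagonal; [now left | exact R1] |].
    destruct (Nat.eq_dec n 1) as [En | Nn]; [eapply residue_diagonal; [now right | exact R1] |].
    intro t. rewrite (Derive_ext _ (fun _ => 0)); [apply Derive_const |].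
    intro s. apply S; [easy |]. now intros [|]. }
  assert (Zb : forall t, Derive (fun _ => 0) t = 0) by (intro; apply Derive_const).
  exists (al 0), (ga 0 0), (si 0 0). split; [now apply S |].
  intros t x u v. unfold affine_in_uv.
  rewrite (constant_remainder _ _ _ _ _ _ Hphi Za Zb R1 t x).
  rewrite (constant_remainder _ _ _ _ _ _ Hpsi Za Zb R2 t x).
  replace (al t) with (al 0); [split; ring |].
  symmetry. refine (constant_of_derive_zero _ _ (fun s => _) Za t).
  eapply Derive_correct, ex_intro, affine_derive_alpha, Hphi.
Qed.

(** Here f_u = a (2u + v) and g_u = a v, so the residue is affine in (u, v).  Its
    coefficients give 2a gamma_x = 2a sigma_x = - alpha'; hence gamma_xxx = 0,
    gamma_t = 0, and alpha' is constant. *)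
Lemma sum_classification phi psi : sum_case -> is_substitution 3 F1 F2 phi psi ->
  exists c1 c2 c4 c5,
  forall t x u v, phi t x u v = (2 * a * c1 * t + c2) * (v + u) - c1 * x + c4 /\
                  psi t x u v = (2 * a * c1 * t + c2) * (v + u) - c1 * x + c5.
Proof.
  intros HS H. assert (Hphi := proj1 H). assert (Hpsi := proj1 (proj2 H)).
  destruct (determining_of_substitution _ _ H) as (al & be & ga & si & -> & -> & S & R1 & R2).
  assert (Eb : be = al).
  { apply functional_extensionality; intro t. now apply S. }
  subst be. clear S. destruct HS as [Hb Hn]. assert (Na : a <> 0) by tauto.
  assert (F : forall X Y u v, flux1 u v * X + flux2 v u * Y = a * ((2 * u + v) * X + v * Y)).
  { intros X Y u v. unfold flux1, flux2. rewrite Hb, Hn. simpl. ring. }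
  assert (G : forall g s t x, no_flux_residue al al g s ->
    2 * a * Derive (g t) x = - Derive al t /\ 2 * a * Derive (s t) x = - Derive al t).
  { intros g s t x E.
    generalize (E t x 0 0) (E t x 1 0) (E t x 0 1).
    rewrite !(Rplus_assoc _ (flux1 _ _ * _)), !F. lra. }
  set (c1 := Derive al 0 / (2 * a)).
  assert (Gx : forall g s t x, no_flux_residue al al g s ->
    Derive (g t) x = - (Derive al t / (2 * a)) /\ Derive (fun s => g s x) t = 0).
  { intros g s t x E.
    assert (Gx : forall y, Derive (g t) y = - (Derive al t / (2 * a))).
    { intro y. destruct (G g s t y E) as [G1 _]. apply Rmult_eq_reg_l with (2 * a); [| lra].
      rewrite G1. field; easy. }
    split; [apply Gx |].
    generalize (residue_at_rest _ _ _ _ t x E).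
    rewrite (Derive_n_3_constant_slope _ _ x Gx). lra. }
  assert (Gf : forall g s, no_flux_residue al al g s -> smooth (on_jets (affine_in_uv al al g)) ->
     forall t x, g t x = g 0 x /\ g 0 x = - c1 * x + g 0 0).
  { intros g s E Hg t x. split.
    - refine (constant_of_derive_zero (fun r => g r x) _ (fun r => _) (fun r => proj2 (Gx g s r x E)) t).
      eapply Derive_correct, ex_intro, affine_derive_gamma_t, Hg.
    - refine (constant_slope_affine _ _ _ (fun r => _) (fun r => proj1 (Gx g s 0 r E)) x).
      eapply Derive_correct, ex_intro, affine_derive_gamma_x, Hg. }
  assert (Da : forall t, Derive al t = 2 * a * c1).
  { intro t. assert (Gt : Derive (ga t) 0 = Derive (ga 0) 0).
    { apply Derive_ext. intro r. apply (Gf _ _ R1 Hphi). }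
    rewrite (proj1 (Gx _ _ t 0 R1)), (proj1 (Gx _ _ 0 0 R1)) in Gt.
    apply Ropp_eq_compat in Gt. rewrite !Ropp_involutive in Gt. fold c1 in Gt.
    rewrite <- Gt. field; easy. }
  exists c1, (al 0), (ga 0 0), (si 0 0).
  intros t x u v. unfold affine_in_uv.
  destruct (Gf _ _ R1 Hphi t x) as [-> ->]. destruct (Gf _ _ R2 Hpsi t x) as [-> ->].
  replace (al t) with (2 * a * c1 * t + al 0); [split; ring |].
  symmetry. refine (constant_slope_affine _ _ _ (fun s => _) Da t).
  eapply Derive_correct, ex_intro, affine_derive_alpha, Hphi.
Qed.

End System.

Theorem proposition2 (a b c : R) (p : nat)
    (hc : c <> 0) (hab : ~ (a = 0 /\ b = 0)) (hp : (1 <= p)%nat) :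
  let F1 := eqF1 a b c p in
  let F2 := eqF2 a b c p in
  nonlinearly_self_adjoint 3 F1 F2 /\
  (a = 0 \/ p = 2%nat ->
     forall phi psi : R -> R -> R -> R -> R,
       is_substitution 3 F1 F2 phi psi <->
       not_both_zero phi psi /\
       exists c3 c4 c5 : R, forall t x u v : R,
         phi t x u v = c3 * u + c4 /\ psi t x u v = c3 * v + c5) /\
  (b = 0 /\ p = 1%nat ->
     forall phi psi : R -> R -> R -> R -> R,
       is_substitution 3 F1 F2 phi psi <->
       not_both_zero phi psi /\
       exists c1 c2 c4 c5 : R, forall t x u v : R,
         phi t x u v = (2 * a * c1 * t + c2) * (v + u) - c1 * x + c4 /\
         psi t x u v = (2 * a * c1 * t + c2) * (v + u) - c1 * x + c5) /\
  (~ (a = 0 \/ p = 2%nat) -> ~ (b = 0 /\ p = 1%nat) ->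
     forall phi psi : R -> R -> R -> R -> R,
       is_substitution 3 F1 F2 phi psi <->
       not_both_zero phi psi /\
       exists c4 c5 : R, forall t x u v : R,
         phi t x u v = c4 /\ psi t x u v = c5).
Proof.
  destruct p as [|n]; [lia |]. clear hp. intros F1 F2.
  assert (NZ : forall phi psi, is_substitution 3 F1 F2 phi psi -> not_both_zero phi psi).
  { intros phi psi H. apply H. }
  assert (Ediag : (a = 0 \/ S n = 2%nat) <-> diagonal_case a n).
  { unfold diagonal_case. split; (intros [|]; [now left | right; lia]). }
  assert (Esum : (b = 0 /\ S n = 1%nat) <-> sum_case b n).
  { unfold sum_case. split; (intros [? ?]; split; [easy | lia]). }
  rewrite Ediag, Esum. clear Ediag Esum.
  split; [| split; [| split]].
  - exists (fun _ _ _ _ => 1), (fun _ _ _ _ => 0).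
    apply (diagonal_substitution a b c n 0 1 0); [now right | | intros; split; ring].
    intro Z. destruct (Z 0 0 0 0). lra.
  - intros HD phi psi. split.
    + intro H. split; [now apply NZ |].
      destruct (not_sum_classification a b c n hc hab phi psi) as (c3 & c4 & c5 & _ & E); [| easy |].
      * intros [Eb En]. destruct HD as [Ea | En']; [tauto | congruence].
      * now exists c3, c4, c5.
    + intros [Hnz (c3 & c4 & c5 & E)].
      now apply (diagonal_substitution a b c n c3 c4 c5); [left | |].
  - intros HS phi psi. split.
    + intro H. split; [now apply NZ |]. now apply (sum_classification a b c n hc hab).
    + intros [Hnz (c1 & c2 & c4 & c5 & E)]. now apply (sum_substitution a b c n c1 c2 c4 c5).
  - intros ND NS phi psi. split.
    + intro H. split; [now apply NZ |].
      destruct (not_sum_classification a b c n hc hab phi psi NS H) as (c3 & c4 & c5 & Z & E).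
      exists c4, c5. intros t x u v. rewrite (proj1 (E t x u v)), (proj2 (E t x u v)), (Z ND).
      split; ring.
    + intros [Hnz (c4 & c5 & E)]. apply (diagonal_substitution a b c n 0 c4 c5); [now right | easy |].
      intros t x u v. rewrite (proj1 (E t x u v)), (proj2 (E t x u v)). split; ring.
Qed.
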